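(* Let $k$ be a field of characteristic zero. The base rank of the variety of dual Leibniz algebras over $k$ is equal to one.
   Context: An algebra over a field $k$ is a $k$-vector space with a bilinear multiplication (not necessarily associative or unital). A dual Leibniz algebra (also called a Zinbiel algebra) over $k$ is an algebra $A$ over $k$ satisfying the identity $(xy)z=x(zy+yz)$ for all $x,y,z\in A$. A variety of algebras over $k$ is the class of all algebras over $k$ satisfying a given set of identities (nonassociative polynomials over $k$ without constant term, required to vanish under all substitutions of elements of the algebra). For an algebra $B$, $Var(B)$ denotes the variety generated by $B$, i.e. the class of all algebras over $k$ satisfying every identity satisfied by $B$. For a variety $\mathfrak{M}$ of algebras over $k$, let $k_{\mathfrak{M}}\langle x_1,\ldots,x_n\rangle$ be the free algebra of $\mathfrak{M}$ in the variables $x_1,\ldots,x_n$. The base rank $rb(\mathfrak{M})$ is the least natural number $n\geq 1$ such that $Var(k_{\mathfrak{M}}\langle x_1,\ldots,x_n\rangle)=\mathfrak{M}$, and $rb(\mathfrak{M})=\infty$ if no such $n$ exists. *)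

(* Defs.v *)
From HB Require Import structures.
From mathcomp Require Import all_boot all_order all_algebra.
From mathcomp Require Import boolp classical_sets.
From mathcomp Require Import finmap monalg.

Set Implicit Arguments.
Unset Strict Implicit.
Unset Printing Implicit Defensive.

Import GRing.Theory.

Local Open Scope quotient_scope.
Local Open Scope ring_scope.

HB.mixin Record Lmodule_isNAAlgebra (k : fieldType) A of GRing.Lmodule k A := {
  amul : A -> A -> A;
  amul_linearl : forall y : A, linear (amul^~ y);
  amul_linearr : forall x : A, linear (amul x)
}.

(* Not necessarily associative, not necessarily unital. *)
#[short(type="naAlgType")]
HB.structure Definition NAAlgebra (k : fieldType) :=
  { A of GRing.Lmodule k A & Lmodule_isNAAlgebra k A }.

Notation "x ** y" := (amul x y) (at level 40, left associativity) : ring_scope.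

HB.instance Definition _ (k : fieldType) (A : naAlgType k) (x : A) :=
  GRing.isLinear.Build k A A *:%R (amul x) (amul_linearr x).

Lemma amulDl k (A : naAlgType k) (x y z : A) : (x + y) ** z = x ** z + y ** z.
Proof. by have := amul_linearl z 1 x y; rewrite !scale1r. Qed.

Lemma amul0l k (A : naAlgType k) (z : A) : 0 ** z = 0.
Proof. by apply: (addrI (0 ** z)); rewrite -amulDl !addr0. Qed.

Lemma amulZl k (A : naAlgType k) (c : k) (x z : A) : (c *: x) ** z = c *: (x ** z).
Proof. by have := amul_linearl z c x 0; rewrite amul0l !addr0. Qed.

Lemma amulNl k (A : naAlgType k) (x z : A) : (- x) ** z = - (x ** z).
Proof. by rewrite -scaleN1r amulZl scaleN1r. Qed.

Lemma amul_suml k (A : naAlgType k) I (r : seq I) (F : I -> A) (z : A) :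
  (\sum_(i <- r) F i) ** z = \sum_(i <- r) F i ** z.
Proof.
by elim/big_rec2: _ => [|i y1 y2 _ <-]; rewrite ?amul0l ?amulDl.
Qed.

Definition alg_hom k (A B : naAlgType k) (f : A -> B) :=
  linear f /\ {morph f : x y / x ** y}.

(* The free magma: nonassociative words of positive length. *)
Inductive magma (X : Type) := MVar of X | MMul of magma X & magma X.

Section MagmaChoice.
Variable X : choiceType.

Fixpoint magma_encode (w : magma X) : GenTree.tree X :=
  match w with
  | MVar x => GenTree.Leaf x
  | MMul u v => GenTree.Node 0 [:: magma_encode u; magma_encode v]
  end.

Fixpoint magma_decode (t : GenTree.tree X) : option (magma X) :=
  match t with
  | GenTree.Leaf x => Some (MVar x)
  | GenTree.Node _ [:: t1; t2] =>
      if (magma_decode t1, magma_decode t2) is (Some u, Some v)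
      then Some (MMul u v) else None
  | _ => None
  end.

Lemma magma_encodeK : pcancel magma_encode magma_decode.
Proof. by elim=> //= u -> v ->. Qed.

HB.instance Definition _ := Choice.copy (magma X) (pcan_type magma_encodeK).

End MagmaChoice.

(* The linear extension to the free module of a map defined on its basis. *)
Section LinearExtension.
Variables (k : fieldType) (K : choiceType) (V : lmodType k) (f : K -> V).

Definition linext (p : {malg k[K]}) : V := \sum_(m <- msupp p) p@_m *: f m.

Lemma linextEw (p : {malg k[K]}) (d : {fset K}) :
  fsubset (msupp p) d -> linext p = \sum_(m <- d) p@_m *: f m.
Proof.
move=> sub; rewrite /linext (big_fset_incl _ sub) // => m _.
by move/mcoeff_outdom ->; rewrite scale0r.
Qed.

Lemma linext_is_linear : linear linext.
Proof.
move=> c p q; pose d := fsetU (msupp p) (msupp q).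
have sp : fsubset (msupp p) d by apply: fsubsetUl.
have sq : fsubset (msupp q) d by apply: fsubsetUr.
have sr : fsubset (msupp (c *: p + q)) d.
  by apply: (fsubset_trans (msuppD_le _ _)); apply/fsetSU/msuppZ_le.
rewrite (linextEw sp) (linextEw sq) (linextEw sr) scaler_sumr -big_split /=.
by apply: eq_bigr => m _; rewrite mcoeffD mcoeffZ scalerDl scalerA.
Qed.

HB.instance Definition _ :=
  GRing.isLinear.Build k {malg k[K]} V *:%R linext linext_is_linear.

Lemma linextU m : linext << m >> = f m.
Proof.
by rewrite /linext msuppU oner_eq0 big_seq_fset1 mcoeffUU scale1r.
Qed.

End LinearExtension.

Lemma monalgUZ (k : fieldType) (K : choiceType) (c : k) (m : K) :
  << c *g m >> = c *: << m >>.
Proof. by apply/malgP => v; rewrite mcoeffZ !mcoeffU mulrnAr mulr1. Qed.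

(* Nonassociative polynomials without constant term: the free nonassociative
   algebra on X, i.e. the k-module with basis the free magma on X. *)
Definition napoly (k : fieldType) (X : choiceType) := {malg k[magma X]}.

HB.instance Definition _ (k : fieldType) (X : choiceType) :=
  GRing.Lmodule.copy (napoly k X) {malg k[magma X]}.

(* Locked to keep unification from unfolding the concrete module operations. *)
HB.lock Definition napoly_mul (k : fieldType) (X : choiceType) (p q : napoly k X) :
    napoly k X :=
  linext (fun u => linext (fun v => << MMul u v >> : napoly k X) q) p.

HB.lock Definition navar (k : fieldType) (X : choiceType) (x : X) : napoly k X :=
  << MVar x >>.

Arguments navar k {X} x.

Section NAPoly.
Variables (k : fieldType) (X : choiceType).
Implicit Types p q : napoly k X.

Lemma napoly_mul_linearl q : linear ((@napoly_mul k X)^~ q).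
Proof. by move=> c p1 p2; rewrite napoly_mul.unlock linearP. Qed.

Lemma napoly_mul_linearr p : linear (napoly_mul p).
Proof.
move=> c q1 q2; rewrite napoly_mul.unlock /linext scaler_sumr -big_split /=.
apply: eq_bigr => u _; rewrite -!/(linext _ _) linearP scalerDr !scalerA.
by rewrite mulrC.
Qed.

HB.instance Definition _ := Lmodule_isNAAlgebra.Build k (napoly k X)
  napoly_mul_linearl napoly_mul_linearr.

Section Eval.
Variables (A : naAlgType k) (a : X -> A).

Fixpoint magma_eval (w : magma X) : A :=
  match w with
  | MVar x => a x
  | MMul u v => magma_eval u ** magma_eval v
  end.

Definition naeval (p : napoly k X) : A := linext magma_eval p.

Lemma naeval_is_linear : linear naeval.
Proof. exact: linearP. Qed.

HB.instance Definition _ :=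
  GRing.isLinear.Build k (napoly k X) A *:%R naeval naeval_is_linear.

Lemma naevalD p q : naeval (p + q) = naeval p + naeval q.
Proof. exact: linearD. Qed.

Lemma naevalB p q : naeval (p - q) = naeval p - naeval q.
Proof. exact: linearB. Qed.

Lemma naevalX x : naeval (navar k x) = a x.
Proof. by rewrite navar.unlock /naeval linextU. Qed.

Lemma naevalM p q : naeval (p ** q) = naeval p ** naeval q.
Proof.
rewrite {1}/amul /= napoly_mul.unlock {1}/linext linear_sum {2}/naeval amul_suml.
apply: eq_bigr => u _; rewrite linearZ amulZl; congr (_ *: _).
rewrite {1}/linext linear_sum /linext linear_sum.
by apply: eq_bigr => v _; rewrite !linearZ /= /naeval linextU.
Qed.

End Eval.

Lemma alg_hom_naeval (A B : naAlgType k) (f : A -> B) (a : X -> A) p :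
  alg_hom f -> f (naeval a p) = naeval (f \o a) p.
Proof.
move=> [flin fM]; pose lf := GRing.isLinear.Build k A B *:%R f flin.
pose F : {linear A -> B} := HB.pack f lf.
rewrite /naeval /linext -[f _]/(F _) linear_sum; apply: eq_bigr => w _.
rewrite linearZ; congr (_ *: _).
by elim: w => //= u IHu v IHv; rewrite fM; congr (_ ** _).
Qed.

End NAPoly.

(* Identities are polynomials in the countably many variables indexed by nat. *)
Definition satisfies (k : fieldType) (A : naAlgType k) (p : napoly k nat) : Prop :=
  forall a : nat -> A, naeval a p = 0.

(* [set (naAlgType k)] would be a universe inconsistency; for the same reason
   classes are compared extensionally. *)
Definition alg_class (k : fieldType) := naAlgType k -> Prop.

Definition eq_class (k : fieldType) (M N : alg_class k) : Prop :=
  forall A, M A <-> N A.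

Definition variety_of (k : fieldType) (S : set (napoly k nat)) : alg_class k :=
  fun A => forall p, S p -> satisfies A p.

Definition is_variety (k : fieldType) (M : alg_class k) : Prop :=
  exists S, eq_class M (variety_of S).

Definition Var (k : fieldType) (B : naAlgType k) : alg_class k :=
  variety_of (satisfies B).

Section IdIdeal.
Variables (k : fieldType) (M : alg_class k) (X : choiceType).
Implicit Types p q : napoly k X.

Definition id_ideal : {pred napoly k X} :=
  fun p => `[< forall A : naAlgType k, M A -> forall a : X -> A, naeval a p = 0 >].

Lemma id_idealP p :
  reflect (forall A : naAlgType k, M A -> forall a : X -> A, naeval a p = 0)
          (p \in id_ideal).
Proof. exact: asboolP. Qed.

Lemma id_ideal_zmod_closed : zmod_closed id_ideal.
Proof.
split=> [|p q /id_idealP p0 /id_idealP q0]; apply/id_idealP => A MA a.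
  by rewrite linear0.
by rewrite linearB /= p0 // q0 // subr0.
Qed.

HB.instance Definition _ :=
  GRing.isZmodClosed.Build (napoly k X) id_ideal id_ideal_zmod_closed.

Lemma id_idealZ c p : p \in id_ideal -> c *: p \in id_ideal.
Proof.
by move=> /id_idealP p0; apply/id_idealP => A MA a; rewrite linearZ /= p0 // scaler0.
Qed.

Lemma id_idealMl p q : p \in id_ideal -> p ** q \in id_ideal.
Proof.
by move=> /id_idealP p0; apply/id_idealP => A MA a; rewrite naevalM p0 // amul0l.
Qed.

Lemma id_idealMr p q : q \in id_ideal -> p ** q \in id_ideal.
Proof.
by move=> /id_idealP q0; apply/id_idealP => A MA a; rewrite naevalM q0 // linear0.
Qed.

End IdIdeal.

Section FreeAlgZmod.
Variables (k : fieldType) (M : alg_class k) (X : choiceType).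

(* The free algebra of M on X is the quotient of the free nonassociative algebra
   on X by the ideal of the polynomials vanishing identically on all algebras
   of M. *)
Definition free_alg := {ideal_quot (id_ideal M (X := X))}.

HB.instance Definition _ := GRing.Zmodule.on free_alg.
HB.instance Definition _ := EqQuotient.on free_alg.

End FreeAlgZmod.

HB.lock Definition free_pi (k : fieldType) (M : alg_class k) (X : choiceType)
    (p : napoly k X) : free_alg M X := \pi_{ideal_quot (id_ideal M (X := X))} p.

HB.lock Definition free_scale (k : fieldType) (M : alg_class k) (X : choiceType)
    (c : k) (x : free_alg M X) : free_alg M X := free_pi M (c *: repr x).

HB.lock Definition free_mul (k : fieldType) (M : alg_class k) (X : choiceType)
    (x y : free_alg M X) : free_alg M X := free_pi M (repr x ** repr y).

Section FreeAlgebra.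
Variables (k : fieldType) (M : alg_class k) (X : choiceType).
Implicit Types p q : napoly k X.

Local Notation id_ideal := (id_ideal M (X := X)).
Local Notation free_alg := (free_alg M X).
Local Notation free_pi := (@free_pi k M X).
Local Notation free_scale := (@free_scale k M X).
Local Notation free_mul := (@free_mul k M X).

Lemma free_pi_eq p q : (free_pi p = free_pi q) <-> (p - q \in id_ideal).
Proof. by rewrite free_pi.unlock Quotient.idealrBE; split=> [/eqP|/eqP]. Qed.

Lemma free_reprK (x : free_alg) : free_pi (repr x) = x.
Proof. by rewrite free_pi.unlock; exact: reprK. Qed.

Lemma free_piB p q : free_pi (p - q) = free_pi p - free_pi q.
Proof. by rewrite free_pi.unlock; exact: raddfB. Qed.

Lemma free_piD p q : free_pi (p + q) = free_pi p + free_pi q.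
Proof. by rewrite free_pi.unlock; exact: raddfD. Qed.

Lemma free_piZ c p : free_pi (c *: p) = free_scale c (free_pi p).
Proof.
rewrite free_scale.unlock; apply/free_pi_eq; rewrite -scalerBr; apply/id_idealZ/free_pi_eq.
by rewrite free_reprK.
Qed.

Lemma free_piM p q : free_pi (p ** q) = free_mul (free_pi p) (free_pi q).
Proof.
rewrite free_mul.unlock; set p' := repr (free_pi p); set q' := repr (free_pi q); apply/free_pi_eq.
have pp : p - p' \in id_ideal by apply/free_pi_eq; rewrite free_reprK.
have qq : q - q' \in id_ideal by apply/free_pi_eq; rewrite free_reprK.
have -> : p ** q - p' ** q' = (p - p') ** q + p' ** (q - q').
  by rewrite linearB /= amulDl amulNl addrA addrNK.
by apply: rpredD; [apply: id_idealMl | apply: id_idealMr].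
Qed.

Lemma free_scaleA c d x : free_scale c (free_scale d x) = free_scale (c * d) x.
Proof. by rewrite -[x]free_reprK -!free_piZ scalerA. Qed.

Lemma free_scale1 : left_id 1 free_scale.
Proof. by move=> x; rewrite -[x]free_reprK -!free_piZ scale1r. Qed.

Lemma free_scaleDr : right_distributive free_scale +%R.
Proof.
move=> c x y; rewrite -[x]free_reprK -[y]free_reprK.
by rewrite -free_piD -!free_piZ -free_piD scalerDr.
Qed.

Lemma free_scaleDl x : {morph free_scale^~ x : c d / c + d}.
Proof.
by move=> c d; rewrite -[x]free_reprK -!free_piZ -free_piD scalerDl.
Qed.

HB.instance Definition _ := GRing.Zmodule_isLmodule.Build k free_alg
  free_scaleA free_scale1 free_scaleDr free_scaleDl.

Lemma free_pi_linear : linear free_pi.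
Proof. by move=> c p q; rewrite free_piD free_piZ. Qed.

Lemma free_mul_linearl y : linear (free_mul^~ y).
Proof.
move=> c x1 x2; rewrite -[x1]free_reprK -[x2]free_reprK -[y]free_reprK.
move: (repr x1) (repr x2) (repr y) => p1 p2 q.
by rewrite -(free_pi_linear c p1 p2) -3!free_piM amul_linearl free_pi_linear.
Qed.

Lemma free_mul_linearr x : linear (free_mul x).
Proof.
move=> c y1 y2; rewrite -[x]free_reprK -[y1]free_reprK -[y2]free_reprK.
move: (repr x) (repr y1) (repr y2) => p q1 q2.
by rewrite -(free_pi_linear c q1 q2) -3!free_piM amul_linearr free_pi_linear.
Qed.

HB.instance Definition _ := Lmodule_isNAAlgebra.Build k free_alg
  free_mul_linearl free_mul_linearr.

Lemma free_pi_hom : alg_hom free_pi.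
Proof. by split; [exact: free_pi_linear | exact: free_piM]. Qed.

Definition free_var (x : X) : free_alg := free_pi (navar k x).

Lemma free_algP (A : naAlgType k) (a : X -> A) : M A ->
  exists f : free_alg -> A,
    [/\ alg_hom f, forall x, f (free_var x) = a x
      & forall g : free_alg -> A,
          alg_hom g -> (forall x, g (free_var x) = a x) -> g = f].
Proof.
move=> MA; pose f (z : free_alg) : A := naeval a (repr z).
have fpi p : f (free_pi p) = naeval a p.
  have /free_pi_eq/id_idealP/(_ A MA a) : free_pi (repr (free_pi p)) = free_pi p.
    by rewrite free_reprK.
  by rewrite linearB => /subr0_eq.
exists f; split.
- split=> [c x y|x y]; rewrite -[x]free_reprK -[y]free_reprK.
    by rewrite -free_pi_linear !fpi linearP.
  by rewrite -free_pi_hom.2 !fpi naevalM.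
- by move=> x; rewrite fpi naevalX.
move=> g ghom ga; apply/funext => z; rewrite -[z]free_reprK fpi.
have pE (p : napoly k X) : p = naeval (navar k) p.
  rewrite [LHS]monalgE /naeval /linext; apply: eq_bigr => w _.
  have <- : << w >> = magma_eval (navar k) w.
    elim: w => [x|u /= <- v <-]; first by rewrite navar.unlock.
    by rewrite /amul /= napoly_mul.unlock !linextU.
  exact: monalgUZ.
rewrite [in LHS](pE (repr z)) (alg_hom_naeval _ _ free_pi_hom).
rewrite (alg_hom_naeval _ _ ghom).
by congr (naeval _ _); apply/funext => x; apply: ga.
Qed.

Lemma free_alg_in_variety : is_variety M -> M free_alg.
Proof.
move=> [S ME]; have MP A : M A -> forall r, S r -> satisfies A r by move=> /ME.
apply/ME => r Sr a; pose b i := repr (a i).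
have -> : a = free_pi \o b by apply/funext => i; rewrite /= free_reprK.
rewrite -(alg_hom_naeval _ _ free_pi_hom).
have -> : 0 = free_pi 0 by rewrite -(subrr (0 : napoly k X)) free_piB subrr.
apply/free_pi_eq; rewrite subr0; apply/id_idealP => A MA c.
rewrite alg_hom_naeval; last by split; [exact: linearP | exact: naevalM].
exact: MP.
Qed.

End FreeAlgebra.

Definition generated_in_rank (k : fieldType) (M : alg_class k) (n : nat) : Prop :=
  (1 <= n)%N /\ eq_class (Var (free_alg M 'I_n)) M.

(* [None] stands for an infinite base rank. *)
Definition base_rank (k : fieldType) (M : alg_class k) : option nat :=
  if pselect (exists n, `[< generated_in_rank M n >]) is left ex_n
  then Some (ex_minn ex_n) else None.

Definition dual_leibniz (k : fieldType) : alg_class k := fun A =>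
  forall x y z : A, (x ** y) ** z = x ** (z ** y + y ** z).

Arguments dual_leibniz k A : clear implicits.

Lemma dual_leibniz_is_variety (k : fieldType) : is_variety (dual_leibniz k).
Proof.
pose X : nat -> napoly k nat := navar k.
pose r := (X 0%N ** X 1%N) ** X 2%N - X 0%N ** (X 2%N ** X 1%N + X 1%N ** X 2%N).
have rE (A : naAlgType k) (a : nat -> A) : naeval a r =
    (a 0%N ** a 1%N) ** a 2%N - a 0%N ** (a 2%N ** a 1%N + a 1%N ** a 2%N).
  by rewrite naevalB !naevalM naevalD !naevalM !naevalX.
exists [set r]%classic => A; split=> HA; first by move=> _ -> a; rewrite rE HA subrr.
move=> x y z; apply: subr0_eq.
by rewrite -(HA r erefl (fun i => nth 0 [:: x; y; z] i)) rE.
Qed.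

(* Main.v *)
Require Import Defs.
From HB Require Import structures.
From mathcomp Require Import all_boot all_order all_algebra.
From mathcomp Require Import boolp zify.
From mathcomp Require Import finmap monalg.

(** Write V for the variety of dual Leibniz algebras. It is enough to show that
    an identity of the free V-algebra on one generator holds in every V-algebra.

    Consider k[t] with the product p ** q = p * int_0^t q. Integration by parts
    says that it lies in V ([int_alg_dual_leibniz]), and it is generated by 1,
    because 1 ** t^n = t^(n+1) / (n+1) and n+1 is invertible in characteristic
    zero. So it is a quotient of the free V-algebra of rank one, and satisfies
    every identity of that algebra. What remains is that k[t] with this product
    satisfies no identity beyond those of V ([int_alg_identity]).

    In a V-algebra the defining identity rewrites the product of two
    right-normed monomials x1 (x2 (... xn)) as a sum of such monomials, over
    half of the shuffles of the two words. Hence every nonassociative polynomial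
    is equal, in all V-algebras at once, to a combination of right-normed words,
    its normal form ([naeval_normal_form]). In k[t] a word evaluates, up to one
    integration, to an iterated integral: the integral of
    P_x1(t1) ... P_xn(tn) over t > t1 > ... > tn > 0.
    So it suffices that distinct words have linearly independent iterated
    integrals, regarded as functions of the polynomials P_x ([iter_int_free]).

    For this, add n t^(n-1) to P_j. As n grows this approximates a Dirac mass at
    t = 1, where only the outermost integration variable can sit: in the limit,
    and to first order, the integral of a word is incremented by that of the
    word without its first letter if this letter is j, and by 0 otherwise
    ([increment_lim]). Hence a linear relation between the integrals of words
    gives one between the integrals of the words that follow a given first
    letter. Repeating this turns any chosen coefficient of the relation into the
    coefficient of the empty word, which vanishes, as evaluation at P = 0 shows.

    Over an arbitrary field of characteristic zero, limits as n grows are taken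
    for quantities that are rational functions of 1/n regular at 0. *)

Set Implicit Arguments.
Unset Strict Implicit.
Unset Printing Implicit Defensive.

Import GRing.Theory.
Local Open Scope ring_scope.

(** * Normal forms: right-normed words *)

Section Shuffle.
Context {X : eqType}.
Implicit Types u v w : seq X.

Fixpoint shuffle u : seq X -> seq (seq X) :=
  fix shuffle_u v := match u, v with
  | [::], _ => [:: v]
  | _, [::] => [:: u]
  | x :: u', y :: v' =>
      [seq x :: w | w <- shuffle u' v] ++ [seq y :: w | w <- shuffle_u v']
  end.

(** The product of two right-normed words in a dual Leibniz algebra is the sum
    over these shuffles, where the first letter of [u] stays in front. *)
Definition half_shuffle u v : seq (seq X) :=
  if u is x :: u' then [seq x :: w | w <- shuffle u' v] else [::].

Lemma shuffle_cons x u y v :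
  shuffle (x :: u) (y :: v) =
  [seq x :: w | w <- shuffle u (y :: v)] ++ [seq y :: w | w <- shuffle (x :: u) v].
Proof. by []. Qed.

Lemma nil_shuffle u v : u != [::] -> [::] \notin shuffle u v.
Proof.
case: u v => // x u [|y v] _ //=.
by rewrite mem_cat; apply/norP; split; apply/mapP => -[].
Qed.

Lemma nil_half_shuffle u v : [::] \notin half_shuffle u v.
Proof. by case: u => // x u; apply/mapP => -[]. Qed.

(** A sequence rather than a set: multiplicities are the coefficients of the
    normal form. *)
Fixpoint magma_words (m : magma X) : seq (seq X) :=
  match m with
  | MVar x => [:: [:: x]]
  | MMul m1 m2 =>
      flatten [seq half_shuffle u v | u <- magma_words m1, v <- magma_words m2]
  end.

Lemma nil_magma_words m : [::] \notin magma_words m.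
Proof.
case: m => // m1 m2; apply/flattenP => -[s /allpairsP[[u v] [_ _ ->]]].
exact/negP/nil_half_shuffle.
Qed.

End Shuffle.

Section WordEval.
Variables (X : choiceType) (k : fieldType) (A : naAlgType k) (a : X -> A).

(** Without a unit in [A] the empty word has no meaningful value; 0 is a
    placeholder, and the empty word never occurs in a normal form. *)
Fixpoint word_eval (w : seq X) : A :=
  match w with
  | [::] => 0
  | [:: x] => a x
  | x :: w' => a x ** word_eval w'
  end.

Lemma word_eval_cons x w : w != [::] -> word_eval (x :: w) = a x ** word_eval w.
Proof. by case: w. Qed.

Lemma sum_word_eval_cons x (s : seq (seq X)) : [::] \notin s ->
  \sum_(w <- s) word_eval (x :: w) = a x ** \sum_(w <- s) word_eval w.
Proof.
move=> s0; rewrite linear_sum /= [LHS]big_seq [RHS]big_seq.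
apply: eq_bigr => w ws; apply: word_eval_cons.
by apply: contraNneq s0 => <-.
Qed.

Hypothesis zA : dual_leibniz k A.

(** Shuffles split according to their first letter. Those starting with the
    first letter x of [u] add up to [u ** v] by the defining identity: for
    [u = x ** u'], it turns [(x ** u') ** v] into [x] times the symmetrized
    product of [u'] and [v], to which induction applies. *)
Lemma word_eval_shuffle u v : u != [::] -> v != [::] ->
  \sum_(w <- shuffle u v) word_eval w =
  word_eval u ** word_eval v + word_eval v ** word_eval u.
Proof.
elim: u v => // x u IHu; elim=> // y v IHv _ _.
rewrite shuffle_cons big_cat !big_map; congr (_ + _).
- case: u IHu {IHv} => [|x' u] IHu; first by rewrite /= big_seq1.
  rewrite sum_word_eval_cons ?IHu ?[word_eval [:: x, x' & u]]word_eval_cons ?zA 1?addrC //.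
  exact: nil_shuffle.
case: v IHv {IHu} => [|y' v] IHv; first by rewrite /= big_seq1.
rewrite sum_word_eval_cons ?IHv ?[word_eval [:: y, y' & v]]word_eval_cons ?zA //.
exact: nil_shuffle.
Qed.

Lemma word_eval_half_shuffle u v : v != [::] ->
  \sum_(w <- half_shuffle u v) word_eval w = word_eval u ** word_eval v.
Proof.
case: u => [|x u] v0 /=; first by rewrite big_nil amul0l.
rewrite big_map; case: u => [|x' u].
  by case: v v0 => // y v _; rewrite /= big_seq1.
rewrite sum_word_eval_cons ?word_eval_shuffle //; first by rewrite zA addrC.
exact: nil_shuffle.
Qed.

Lemma magma_eval_words m : magma_eval a m = \sum_(w <- magma_words m) word_eval w.
Proof.
elim: m => [x|m1 IH1 m2 IH2] /=; first by rewrite big_seq1.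
rewrite IH1 IH2 big_flatten big_allpairs_dep amul_suml; apply: eq_bigr => u _.
rewrite linear_sum /= !big_seq; apply: eq_bigr => v vm.
by rewrite word_eval_half_shuffle //; apply: contraTneq vm => ->; apply: nil_magma_words.
Qed.

End WordEval.

Section NormalForm.
Variables (X : choiceType) (k : fieldType).
Implicit Types p : napoly k X.

Definition normal_form p : {malg k[seq X]} :=
  linext (fun m => \sum_(w <- magma_words m) << w >>) p.

(** The normal form depends on neither the algebra nor the assignment, so it
    reduces an identity to a statement about words. *)
Lemma naeval_normal_form (A : naAlgType k) (a : X -> A) p : dual_leibniz k A ->
  naeval a p = linext (word_eval a) (normal_form p).
Proof.
move=> zA; have -> : normal_form p =
    \sum_(m <- msupp p) p@_m *: \sum_(w <- magma_words m) << w >> by [].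
rewrite linear_sum /=; apply: eq_bigr => m _; rewrite linearZ /=; congr (_ *: _).
rewrite magma_eval_words // linear_sum /=; apply: eq_bigr => w _.
by rewrite linextU.
Qed.

End NormalForm.

(** * Limits of rational functions of 1/n *)

Section RationalLimit.
Variable k : fieldType.
Hypothesis k_char0 : [pchar k] =i pred0.

Lemma natr_neq0 n : (0 < n)%N -> (n%:R != 0 :> k).
Proof. by rewrite ((pcharf0P k).1 k_char0) lt0n. Qed.

(** Eventually [phi n] is the value at 1/n of the rational function p/q, which
    is regular at 0 with value [l]. Stating this without division makes the
    zeros of q harmless. *)
Definition rat_lim (phi : nat -> k) (l : k) :=
  exists n0 (p q : {poly k}), [/\ p.[0] = l, q.[0] = 1
    & forall n, (n0 <= n)%N -> phi n * q.[n%:R^-1] = p.[n%:R^-1]].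

Lemma rat_lim_near phi psi l n0 : (forall n, (n0 <= n)%N -> phi n = psi n) ->
  rat_lim phi l -> rat_lim psi l.
Proof.
move=> e [n1 [p [q [p0 q0 pq]]]]; exists (maxn n0 n1), p, q; split=> // n.
by rewrite geq_max => /andP[h0 h1]; rewrite -e // pq.
Qed.

Lemma rat_lim_cst c : rat_lim (fun=> c) c.
Proof. by exists 0%N, c%:P, 1; split=> [||n _]; rewrite ?hornerC ?mulr1. Qed.

Lemma rat_limD phi psi l m : rat_lim phi l -> rat_lim psi m ->
  rat_lim (fun n => phi n + psi n) (l + m).
Proof.
move=> [n1 [p [q [p0 q0 pq]]]] [n2 [r [s [r0 s0 rs]]]].
exists (maxn n1 n2), (p * s + r * q), (q * s).
split=> [||n]; rewrite ?(hornerD, hornerM) ?p0 ?q0 ?r0 ?s0 ?mulr1 //.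
rewrite geq_max => /andP[h1 h2]; rewrite -pq // -rs //.
by rewrite mulrDl mulrA [q.[_] * _]mulrC mulrA.
Qed.

Lemma rat_limM phi psi l m : rat_lim phi l -> rat_lim psi m ->
  rat_lim (fun n => phi n * psi n) (l * m).
Proof.
move=> [n1 [p [q [p0 q0 pq]]]] [n2 [r [s [r0 s0 rs]]]].
exists (maxn n1 n2), (p * r), (q * s).
split=> [||n]; rewrite ?(hornerD, hornerM) ?p0 ?q0 ?r0 ?s0 ?mulr1 //.
by rewrite geq_max => /andP[h1 h2]; rewrite -pq // -rs // mulrACA.
Qed.

Lemma rat_lim_sum I (r : seq I) (phi : I -> nat -> k) l :
  (forall i, rat_lim (phi i) (l i)) ->
  rat_lim (fun n => \sum_(i <- r) phi i n) (\sum_(i <- r) l i).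
Proof.
move=> h; elim: r => [|i r IH].
  by rewrite big_nil; apply: (rat_lim_near (n0 := 0%N)) (rat_lim_cst 0) => n _; rewrite big_nil.
rewrite big_cons; apply: (rat_lim_near (n0 := 0%N)) (rat_limD (h i) IH) => n _.
by rewrite big_cons.
Qed.

Lemma rat_lim_inv e : rat_lim (fun n => (n + e)%:R^-1) 0.
Proof.
exists 1%N, 'X, (1 + e%:R *: 'X); split=> [||n n0]; rewrite ?hornerE ?mulr0 ?addr0 //.
have n0' := natr_neq0 n0; have ne0 := natr_neq0 (ltn_addr e n0).
apply: (mulfI ne0); rewrite mulrA mulfV // mul1r.
by rewrite natrD mulrDl mulfV.
Qed.

Lemma rat_lim_ratio e : rat_lim (fun n => n%:R / (n + e)%:R) 1.
Proof.
apply: (@rat_lim_near (fun n => 1 + (- e%:R) * (n + e)%:R^-1) _ _ 1) => [n n0|].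
  have ne0 := natr_neq0 (ltn_addr e n0).
  by apply: (mulIf ne0); rewrite mulrDl !divfK // mul1r natrD addrK.
rewrite -[1 in X in rat_lim _ X]addr0; apply: rat_limD; first exact: rat_lim_cst.
by rewrite -[X in rat_lim _ X](mulr0 (- e%:R)); apply: rat_limM (rat_lim_inv e); apply: rat_lim_cst.
Qed.

(** The numerator vanishes at the infinitely many distinct points 1/n, hence is
    the zero polynomial. *)
Lemma rat_lim0 l : rat_lim (fun=> 0) l -> l = 0.
Proof.
move=> [n0 [p [q [<- _ pq]]]]; suff -> : p = 0 by rewrite horner0.
pose s := [seq (n%:R^-1 : k) | n <- iota n0.+1 (size p)].
apply: (@roots_geq_poly_eq0 _ p s).
- apply/allP => _ /mapP[n + ->]; rewrite mem_iota => /andP[h _].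
  by rewrite rootE -pq ?mul0r // ltnW.
- rewrite map_inj_in_uniq ?iota_uniq // => i j _ _ /invr_inj /eqP.
  wlog: i j / (i <= j)%N => [H|ij].
    by case/orP: (leq_total i j) => /H // h; rewrite eq_sym => /h ->.
  rewrite eq_sym -subr_eq0 -natrB // ((pcharf0P k).1 k_char0) subn_eq0 => ji.
  by apply/eqP; rewrite eqn_leq ij ji.
- by rewrite size_map size_iota.
Qed.

End RationalLimit.

(** * Primitives of polynomials *)

Section Primitive.
Variable k : fieldType.
Hypothesis k_char0 : [pchar k] =i pred0.
Implicit Types p q : {poly k}.

(** The constant term is 0, because the inverse of 0 is 0. *)
Definition primitive p : {poly k} := \poly_(i < (size p).+1) (p`_i.-1 / i%:R).

Lemma coef_primitive p i : (primitive p)`_i = p`_i.-1 / i%:R.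
Proof.
rewrite coef_poly; case: ltnP => // si.
by rewrite nth_default ?mul0r // -ltnS prednK // (leq_ltn_trans _ si).
Qed.

Lemma primitive_linear : linear primitive.
Proof.
move=> c p q; apply/polyP => i.
by rewrite !(coefD, coefZ, coef_primitive) mulrDl mulrA.
Qed.

HB.instance Definition _ :=
  GRing.isLinear.Build k {poly k} {poly k} *:%R primitive primitive_linear.

Lemma primitiveZ c p : primitive (c *: p) = c *: primitive p.
Proof. exact: linearZ. Qed.

Lemma coef0_primitive p : (primitive p)`_0 = 0.
Proof. by rewrite coef_primitive invr0 mulr0. Qed.

Lemma deriv_primitive p : (primitive p)^`() = p.
Proof.
apply/polyP => i; rewrite coef_deriv coef_primitive -[LHS]mulr_natr divfK //.
exact: natr_neq0.
Qed.

Lemma deriv_inj p q : p^`() = q^`() -> p`_0 = q`_0 -> p = q.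
Proof.
move=> /polyP d e0; apply/polyP => -[|i] //.
have := d i; rewrite !coef_deriv => di.
by apply: (mulIf (natr_neq0 k_char0 (ltn0Sn i))); rewrite !mulr_natr.
Qed.

Lemma primitive_parts p q :
  primitive (p * primitive q + q * primitive p) = primitive p * primitive q.
Proof.
apply: deriv_inj; first by rewrite derivM !deriv_primitive [q * _]mulrC.
by rewrite coef0M !coef0_primitive mulr0.
Qed.

End Primitive.

(** * Linear independence of iterated integrals *)

Section IteratedIntegral.
Variables (X : choiceType) (k : fieldType).
Hypothesis k_char0 : [pchar k] =i pred0.
Implicit Types (P : X -> {poly k}) (w : seq X).

Definition iter_int P w : {poly k} :=
  foldr (fun x g => primitive (P x * g)) 1 w.

(** The added term n t^(n-1) has integral 1 over [0, 1] and concentrates at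
    t = 1 as n grows. *)
Definition perturb P (j : X) (n : nat) : X -> {poly k} :=
  fun x => P x + (x == j)%:R *: (n%:R *: 'X^(n.-1)).

Definition increment P j n w : {poly k} := iter_int (perturb P j n) w - iter_int P w.

Lemma increment_cons P j n x w : increment P j n (x :: w) =
  primitive (P x * increment P j n w)
  + (x == j)%:R *: (n%:R *: primitive ('X^(n.-1) * (iter_int P w + increment P j n w))).
Proof.
rewrite /increment [iter_int P w + _]addrC subrK /= -linearB -!primitiveZ -linearD /=.
congr primitive; rewrite /perturb mulrDl mulrBr -!scalerAl.
by rewrite addrAC.
Qed.

Lemma coef_increment_lt P j n w i : (i < n)%N -> (increment P j n w)`_i = 0.
Proof.
elim: w i => [|x w IH] i lt_in; first by rewrite /increment subrr coef0.
rewrite increment_cons coefD !coefZ !coef_primitive coefXnM.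
case: i lt_in => [|i] lt_in; first by rewrite invr0 !mulr0 addr0.
rewrite /= coefM big1 => [|[m /= hm] _]; last first.
  by rewrite IH ?mulr0 // (leq_ltn_trans (leq_subr _ _)) // ltnW.
by rewrite -ltnS prednK ?lt_in ?mul0r ?mulr0 ?addr0 // (leq_ltn_trans _ lt_in).
Qed.

(** In degree n + e, integrating divides by n + e. This kills in the limit the
    terms where the perturbation occurs after the first letter, since the
    integration for the first letter is not compensated. When the perturbation
    occurs at the first letter the factor is n / (n + e), which tends to 1. Terms
    of higher order in the perturbation only have degrees from 2 n on, which
    n + e does not reach for n > e. *)
Lemma increment_lim P j w e :
  rat_lim (fun n => (increment P j n w)`_(n + e))
          (if w is x :: w' then (x == j)%:R * (iter_int P w')`_e else 0).
Proof.
elim: w e => [|x w IH] e.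
  apply: (rat_lim_near (n0 := 0%N)) (rat_lim_cst 0) => n _.
  by rewrite /increment subrr coef0.
pose l i := if w is y :: w' then (y == j)%:R * (iter_int P w')`_i else 0.
pose phi n := (\sum_(i < e) (P x)`_i * (increment P j n w)`_(n + (e.-1 - i)))
                * (n + e)%:R^-1
              + (x == j)%:R * (iter_int P w)`_e * (n%:R / (n + e)%:R).
apply: (rat_lim_near (phi := phi) (n0 := e.+1)) => [n lt_en|]; last first.
  rewrite -[X in rat_lim _ X]add0r; apply: rat_limD.
    rewrite -[X in rat_lim _ X](mulr0 (\sum_(i < e) (P x)`_i * l (e.-1 - i)%N)).
    apply: rat_limM (rat_lim_inv k_char0 e).
    apply: rat_lim_sum => i.
    by apply: rat_limM (IH _); apply: rat_lim_cst.
  rewrite -[X in rat_lim _ X]mulr1.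
  by apply: rat_limM (rat_lim_ratio k_char0 e); apply: rat_lim_cst.
have n_gt0 : (0 < n)%N by apply: leq_trans lt_en.
rewrite increment_cons coefD !coefZ !coef_primitive coefXnM coefM /phi.
congr (_ * _ + _).
  have -> : (n + e).-1.+1 = (e + n)%N by lia.
  (* Beyond index e the coefficients of the increment have degree below n. *)
  rewrite big_split_ord /= [X in _ = _ + X]big1 ?addr0 => [|i _]; last first.
    by rewrite coef_increment_lt ?mulr0 //; lia.
  by apply: eq_bigr => i _; congr (_ * _`_ _); have := ltn_ord i; lia.
rewrite ifN; last by rewrite -leqNgt; lia.
have -> : ((n + e).-1 - n.-1 = e)%N by lia.
by rewrite coefD coef_increment_lt // addr0 -mulrA [_`_e * _]mulrCA.
Qed.

Definition left_quotient (j : X) (r : seq (seq X)) : seq (seq X) :=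
  [seq behead w | w <- r & ohead w == Some j].

Lemma mem_left_quotient j r w : (j :: w \in r) = (w \in left_quotient j r).
Proof.
apply/idP/mapP => [jw|[[|x v] + ->]]; first by exists (j :: w) => //; rewrite mem_filter jw eqxx.
  by rewrite mem_filter.
by rewrite mem_filter /= => /andP[/eqP[->]].
Qed.

Lemma left_quotient_uniq j r : uniq r -> uniq (left_quotient j r).
Proof.
move=> r_uniq; rewrite map_inj_in_uniq ?filter_uniq //.
move=> [|x u] [|y v]; rewrite !mem_filter //=.
by move=> /andP[/eqP[->] _] /andP[/eqP[->] _] ->.
Qed.

(** A relation that holds for all [P] holds for their perturbations, hence for
    the increments and, coefficient by coefficient, for their limits. *)
Lemma left_quotient_vanish r (c : seq X -> k) j :
  (forall P, \sum_(w <- r) c w *: iter_int P w = 0) ->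
  forall P, \sum_(w <- left_quotient j r) c (j :: w) *: iter_int P w = 0.
Proof.
move=> r0 P; apply/polyP => e; rewrite coef0 coef_sum.
pose l w := if w is x :: w' then (x == j)%:R * (iter_int P w')`_e else 0.
have l0 : \sum_(w <- r) c w * l w = 0.
  apply: (rat_lim0 k_char0).
  apply: (rat_lim_near (n0 := 0%N)
      (phi := fun n => \sum_(w <- r) c w * (increment P j n w)`_(n + e))) => [n _|].
    have : \sum_(w <- r) c w *: increment P j n w = 0.
      under eq_bigr do rewrite scalerBr.
      by rewrite sumrB !r0 subrr.
    move/(congr1 (fun p : {poly k} => p`_(n + e))); rewrite coef_sum coef0 => E; rewrite -[RHS]E.
    by apply: eq_bigr => w _; rewrite coefZ.
  apply: rat_lim_sum => w; apply: rat_limM (increment_lim P j w e).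
  exact: rat_lim_cst.
rewrite -[RHS]l0 big_map big_filter big_mkcond /=; apply: eq_bigr => -[|x w] _ /=.
  by rewrite mulr0.
rewrite coefZ -[Some x == _]/(x == j); case: eqP => [->|_]; first by rewrite mul1r.
by rewrite mul0r mulr0.
Qed.

Lemma iter_int_free r (c : seq X -> k) : uniq r ->
  (forall P, \sum_(w <- r) c w *: iter_int P w = 0) ->
  forall w, w \in r -> c w = 0.
Proof.
move=> + + w; elim: w r c => [|j w IH] r c r_uniq r0 w_r; last first.
  apply: (IH (left_quotient j r) (fun v => c (j :: v))); first exact: left_quotient_uniq.
    exact: left_quotient_vanish.
  by rewrite -mem_left_quotient.
have := r0 (fun=> 0); rewrite (bigD1_seq [::]) //= big1 => [|[|x v] _] //.
  by rewrite addr0 => /(congr1 (fun p : {poly k} => p`_0)); rewrite coefZ coef1 mulr1 coef0.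
by rewrite /= mul0r linear0 scaler0.
Qed.

End IteratedIntegral.

(** * The integration algebra *)

Section IntegrationAlgebra.
Variable k : fieldType.

(** Differentiation identifies the polynomials f without constant term, with
    product the primitive of f' g, with this algebra. Working with derivatives
    gives all of k[t] as carrier. *)
Definition int_alg := {poly k}.

HB.instance Definition _ := GRing.Lmodule.on int_alg.

Definition int_mul (p q : int_alg) : int_alg := (p : {poly k}) * primitive q.

Lemma int_mul_linearl q : linear (int_mul^~ q).
Proof. by move=> c p1 p2; rewrite /int_mul mulrDl scalerAl. Qed.

Lemma int_mul_linearr p : linear (int_mul p).
Proof. by move=> c q1 q2; rewrite /int_mul linearP mulrDr scalerAr. Qed.

HB.instance Definition _ := Lmodule_isNAAlgebra.Build k int_alg
  int_mul_linearl int_mul_linearr.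

Hypothesis k_char0 : [pchar k] =i pred0.

Lemma int_alg_dual_leibniz : dual_leibniz k int_alg.
Proof.
move=> p q r; rewrite /amul /= /int_mul -mulrA; congr (_ * _).
by rewrite addrC primitive_parts.
Qed.

Lemma primitive_word_eval (X : choiceType) (P : X -> int_alg) w : w != [::] ->
  primitive (word_eval P w : {poly k}) = iter_int P w.
Proof.
elim: w => // x [|y w] IH _; first by rewrite /= mulr1.
by rewrite word_eval_cons // /amul /= /int_mul IH.
Qed.

Lemma normal_form_eq0 (X : choiceType) (q : {malg k[seq X]}) :
  (forall P : X -> int_alg, linext (word_eval P) q = 0) ->
  forall w, w != [::] -> q@_w = 0.
Proof.
move=> q0 w w0; case: (boolP (w \in msupp q)) => [wq|]; last exact: mcoeff_outdom.
apply: (iter_int_free k_char0 (r := [seq v <- msupp q | v != [::]]) (c := fun v => q@_v)).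
- by rewrite filter_uniq // fset_uniq.
- move=> P; have /(congr1 (@primitive k)) := q0 P.
  rewrite linear0 /linext linear_sum /= => E.
  rewrite -[RHS]E big_filter big_mkcond /=; apply: eq_bigr => v _.
  case: eqP => [->|/eqP v0] /=; first by rewrite scaler0 linear0.
  by rewrite (primitiveZ q@_v (word_eval (P : X -> int_alg) v)) primitive_word_eval.
- by rewrite mem_filter w0.
Qed.

(** The normal form of an identity of the integration algebra has no nonzero
    coefficient, because distinct words have independent iterated integrals. *)
Lemma int_alg_identity (p : napoly k nat) (A : naAlgType k) :
  satisfies int_alg p -> dual_leibniz k A -> satisfies A p.
Proof.
move=> p0 zA a; rewrite naeval_normal_form //.
rewrite /linext big1 // => -[_|x w _]; first by rewrite scaler0.
rewrite (@normal_form_eq0 _ (normal_form p)) ?scale0r // => P.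
by rewrite -naeval_normal_form //; apply: int_alg_dual_leibniz.
Qed.

(** The integration algebra is generated by 1: the product of 1 and t^n is
    t^(n+1) / (n+1). *)
Lemma int_alg_cyclic (F : naAlgType k) (f : F -> int_alg) (x : F) :
  alg_hom f -> f x = (1 : {poly k}) -> forall p, exists y, f y = p.
Proof.
move=> [flin fM] fx p.
pose lf := GRing.isLinear.Build k F int_alg *:%R f flin.
pose f' : {linear F -> int_alg} := HB.pack f lf.
have monom n : exists y, f y = ('X^n : {poly k}).
  elim: n => [|n [y fy]]; first by exists x.
  exists (n.+1%:R *: (x ** y)); rewrite -[f _]/(f' _) linearZ /= fM fx fy.
  rewrite /amul /= /int_mul mul1r; apply/polyP => i.
  rewrite coefZ coef_primitive !coefXn; case: i => [|i]; first by rewrite invr0 !mulr0.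
  rewrite eqSS /=; case: eqP => [->|_]; last by rewrite mul0r mulr0.
  by rewrite mul1r mulfV // natr_neq0.
pose y i := sval (cid (monom i)).
exists (\sum_(i < size (p : {poly k})) (p : {poly k})`_i *: y i).
rewrite -[f _]/(f' _) linear_sum -[RHS](coefK p) poly_def; apply: eq_bigr => i _.
by rewrite linearZ /= /y; case: (cid _) => z /= ->.
Qed.

Lemma free_rank1_identity (p : napoly k nat) :
  satisfies (free_alg (dual_leibniz k) 'I_1) p -> satisfies int_alg p.
Proof.
move=> p0 a.
have [f [fhom fx _]] := free_algP (fun _ : 'I_1 => (1 : {poly k}) : int_alg)
  int_alg_dual_leibniz.
have f_surj := int_alg_cyclic fhom (fx ord0).
pose b i := sval (cid (f_surj (a i))).
have -> : a = f \o b by apply/funext => i; rewrite /b /=; case: (cid _).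
rewrite -(alg_hom_naeval _ _ fhom) p0.
by have := fhom.1 (-1) 0 0; rewrite scaler0 addr0 scaleN1r addNr.
Qed.

End IntegrationAlgebra.

(** * The base rank *)

Lemma variety_sub_Var (k : fieldType) (M : alg_class k) (B : naAlgType k) :
  is_variety M -> M B -> forall A, Var B A -> M A.
Proof.
by move=> [S MS] /MS SB A BA; apply/MS => p /SB; apply: BA.
Qed.

Theorem corollary1 (k : fieldType) (k_char0 : [pchar k] =i pred0) :
  base_rank (dual_leibniz k) = Some 1%N.
Proof.
have rank1 : generated_in_rank (dual_leibniz k) 1.
  split=> // A; split; last first.
    by move=> zA p /(free_rank1_identity k_char0)/int_alg_identity; apply.
  have zV := dual_leibniz_is_variety k.
  exact: (variety_sub_Var zV (free_alg_in_variety _ zV)).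
rewrite /base_rank; case: pselect => [ex_n|]; last by case; exists 1%N; apply/asboolP.
case: ex_minnP => n /asboolP[n_gt0 _] n_min; congr Some; apply/eqP.
by rewrite eqn_leq n_gt0 n_min //; apply/asboolP.
Qed.
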